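(* Consider the finite-horizon LQ game with $N$ agents, decoupled dynamics $x^i_{t+1}=A^ix^i_t+b^iu^i_t$ and the decoupled state linear feedback information structure $u^i_t=-k^i_tx^i_t$, with losses $J^i$ as given in the context. If for all $i,j\in\{1,\dots,N\}$ and all $t\in\{0,\dots,t_f-1\}$ both (C1) $(Q^i_{t+1})_{ij}=(Q^j_{t+1})_{ij}$, and (C2) $(R^i_t)_{ij}=(R^j_t)_{ij}$ hold, then the game is a potential game.
   Context: There are $N$ agents and a horizon $t_f\ge1$. Agent $i$ has state $x^i_t\in\mathbb{R}^{n^i}$ and scalar action $u^i_t\in\mathbb{R}$, with $A^i\in\mathbb{R}^{n^i\times n^i}$, $b^i\in\mathbb{R}^{n^i}$, and dynamics $x^i_{t+1}=A^ix^i_t+b^iu^i_t$ for $t\in\{0,\dots,t_f-1\}$. The joint state is $x_t=(x^1_t,\dots,x^N_t)\in\mathbb{R}^n$, $n=\sum_i n^i$, and the joint initial state is random, $x_0\sim\mathcal{D}$. The decision variables of agent $i$ are $\gamma^i_t=k^i_t\in\mathbb{R}^{n^i}$ (acting as a row vector), $u^i_t=-k^i_tx^i_t$, $\gamma^i=(\gamma^i_0,\dots,\gamma^i_{t_f-1})\in\mathbb{R}^{t_fn^i}$, and $\gamma=(\gamma^1,\dots,\gamma^N)$; $\gamma^{-i}$ denotes the decision variables of all agents other than $i$. The real-valued loss of agent $i$ is $$J^i(\gamma)=\mathbb{E}_{x_0\sim\mathcal{D}}\Big[\sum_{t=0}^{t_f}(x_t-d_t)^TQ^i_t(x_t-d_t)+\sum_{t=0}^{t_f-1}\sum_{j=1}^N\sum_{h=1}^N(u^j_t)^T(R^i_t)_{jh}u^h_t\Big],$$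 where $d_t\in\mathbb{R}^n$, $Q^i_t\in\mathbb{R}^{n\times n}$ is positive semi-definite, $(R^i_t)_{jh}=(R^i_t)_{hj}\in\mathbb{R}$, $(R^i_t)_{ll}\ge0$ for $l\ne i$, and $(R^i_t)_{ii}>0$. For $h,l\in\{1,\dots,N\}$, $(Q^i_t)_{hl}\in\mathbb{R}^{n^h\times n^l}$ is the $(h,l)$ block of $Q^i_t$ in the block partition corresponding to $x_t=(x^1_t,\dots,x^N_t)$. Potential game: the game is potential if and only if there exists a real-valued function $\Pi$ of $\gamma$ such that for every $i$, every $\gamma^{-i}$ and all $\gamma^i,\hat\gamma^i\in\mathbb{R}^{t_fn^i}$, $J^i(\gamma^i,\gamma^{-i})-J^i(\hat\gamma^i,\gamma^{-i})=\Pi(\gamma^i,\gamma^{-i})-\Pi(\hat\gamma^i,\gamma^{-i})$. *)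

(* Defs.v *)
(* MathComp / MathComp-Analysis *)
From HB Require Import structures.
From mathcomp Require Export all_boot all_order all_algebra.
From mathcomp Require Export all_classical all_reals all_analysis.

Set Implicit Arguments.
Unset Strict Implicit.
Unset Printing Implicit Defensive.

Import Order.TTheory GRing.Theory Num.Theory.
Import numFieldNormedType.Exports.

Local Open Scope ring_scope.

Definition psd (R : realType) (m : nat) (M : 'M[R]_m) : Prop :=
  M^T = M /\ forall v : 'cV[R]_m, 0 <= (v^T *m M *m v) 0 0.

(* [dfwith s i a] is the profile [s] in which player [i] plays [a] instead
   of [s i], i.e. (a, s^{-i}). *)
Definition potential_game (R : realType) (I : eqType) (S : I -> Type)
    (J : I -> (forall i, S i) -> R) : Prop :=
  exists Pi : (forall i, S i) -> R,
    forall (i : I) (s : forall j, S j) (a a' : S i),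
      J i (dfwith s i a) - J i (dfwith s i a')
      = Pi (dfwith s i a) - Pi (dfwith s i a').

(* [n i] is the dimension of the state of agent [i]; joint states are column
   vectors of length \sum_i n i with the block decomposition of [\mxcol]. The
   law of the initial state is a probability on R^(\sum_i n i), given as tuples
   with the product of the Borel sigma-algebras. *)
Record lq_game (R : realType) (N tf : nat) (n : 'I_N -> nat) := LQGame {
  dynA : forall i : 'I_N, 'M[R]_(n i);
  dynb : forall i : 'I_N, 'cV[R]_(n i);
  target : 'I_tf.+1 -> 'cV[R]_(\sum_(j < N) n j);
  Qcost : 'I_N -> 'I_tf.+1 -> 'M[R]_(\sum_(j < N) n j);
  Rcost : 'I_N -> 'I_tf -> 'M[R]_N;
  init_law : probability ((\sum_(j < N) n j).-tuple (measurableTypeR R)) R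
}.

Section Game.
Context {R : realType} {N tf : nat} {n : 'I_N -> nat}.
Variable G : lq_game R tf n.
Implicit Type i : 'I_N.

(* Row [t] of a strategy of agent [i] is the gain k^i_t. *)
Definition strategy i := 'M[R]_(tf, n i).
Definition profile := forall i, strategy i.
Implicit Type g : profile.

(* Defined for all natural numbers [t] so that the states can be computed by
   recursion on [t]; the value 0 for [tf <= t] is never used in the losses. *)
Definition gain g i (t : nat) : 'rV[R]_(n i) :=
  oapp (fun s : 'I_tf => row s (g i)) 0 (insub t).

Definition feedback g i (t : nat) (x : 'cV[R]_(n i)) : R :=
  - (gain g i t *m x) 0 0.

Fixpoint state g (x0 : 'cV[R]_(\sum_(j < N) n j)) i (t : nat) : 'cV[R]_(n i) :=
  if t is s.+1 then
    dynA G i *m state g x0 i s + feedback g s (state g x0 i s) *: dynb G i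
  else submxcol x0 i.

Definition action g x0 i (t : nat) : R := feedback g t (state g x0 i t).

Definition joint_state g x0 (t : nat) : 'cV[R]_(\sum_(j < N) n j) :=
  \mxcol_(i < N) state g x0 i t.

Definition path_cost i g (x0 : 'cV[R]_(\sum_(j < N) n j)) : R :=
  \sum_(t < tf.+1)
    ((joint_state g x0 t - target G t)^T *m Qcost G i t
       *m (joint_state g x0 t - target G t)) 0 0
  + \sum_(t < tf) \sum_(j < N) \sum_(h < N)
      action g x0 j t * Rcost G i t j h * action g x0 h t.

Definition random_cost i g
    (w : (\sum_(j < N) n j).-tuple (measurableTypeR R)) : R :=
  path_cost i g (\col_k tnth w k).

(* Meaningful only when [random_cost i g] is integrable, see [real_losses]. *)
Definition loss i g : R := fine ('E_(init_law G)[random_cost i g]).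

Definition real_losses : Prop :=
  forall i g, (init_law G).-integrable setT (EFin \o random_cost i g).

End Game.

(* Main.v *)
(* Path by path, the potential sums, over all pairs (j, h), the interaction terms
   weighted as in the cost of agent j. By C1 and C2 agents j and h give their
   interaction the same weight, so every term that agent i can influence is
   weighted as in the cost of i; the cost at time 0 does not depend on the
   gains. The expectation of this potential itself may be undefined, but its
   differences telescope, one deviating agent at a time, into differences of
   integrable realized costs: hence the potential is normalized by its value at
   a fixed profile before taking expectations. *)
Require Import Defs.

Import Order.TTheory GRing.Theory Num.Theory.
Local Open Scope ring_scope.

Section DFWithSeq.
Context {I : eqType} {S : I -> Type}.
Implicit Type s : forall i, S i.

(** Intermediate profiles of the telescoping: the agents in [r] have already switched from [s0] to
    [s]. *)
Definition dfwith_seq s0 s (r : seq I) : forall i, S i :=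
  foldr (fun i u => dfwith u i (s i)) s0 r.

Lemma dfwith_id s i : dfwith s i (s i) = s.
Proof. by apply: functional_extensionality_dep => j; case: dfwithP. Qed.

Lemma dfwith_seqE s0 s r i : i \in r -> dfwith_seq s0 s r i = s i.
Proof.
elim: r => //= j r IH; have [<- _|ji] := eqVneq j i; first by rewrite dfwithin.
by rewrite dfwithout// inE eq_sym (negPf ji).
Qed.

End DFWithSeq.

Section ExpectedPotential.
Context {R : realType} {I : finType} {S : I -> Type}.
Context {d : measure_display} {T : measurableType d} {P : probability T R}.
Implicit Type s : forall i, S i.
Context {X : I -> (forall i, S i) -> T -> R} {Phi : (forall i, S i) -> T -> R}.

Hypothesis X_integrable : forall i s, P.-integrable setT (EFin \o X i s).
Hypothesis X_potential : forall i s (a a' : S i) w,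
  X i (dfwith s i a) w - X i (dfwith s i a') w
  = Phi (dfwith s i a) w - Phi (dfwith s i a') w.

(** A unilateral deviation changes [Phi] exactly as it changes [X i], and both realized costs of [i]
    are integrable. *)
Lemma integrable_potential_step s i (a : S i) :
  P.-integrable setT (EFin \o (Phi (dfwith s i a) \- Phi s)).
Proof.
have /eq_integrable : {in setT, (EFin \o X i (dfwith s i a)) \- (EFin \o X i s)
    =1 EFin \o (Phi (dfwith s i a) \- Phi s)%R}%E.
  move=> w _ /=; rewrite -EFinB -[in X i s w](dfwith_id s i) X_potential.
  by rewrite dfwith_id.
by apply => //; exact: integrableB.
Qed.

Lemma integrable_potential_diff s0 s :
  P.-integrable setT (EFin \o (Phi s \- Phi s0)).
Proof.
(* Taking all agents for [r] recovers [s]; an arbitrary list allows induction, each new element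
   adding one unilateral step. *)
suff H r : P.-integrable setT (EFin \o (Phi (dfwith_seq s0 s r) \- Phi s0)).
  have := H (enum I); congr (_.-integrable _ (EFin \o (Phi _ \- _))).
  by apply: functional_extensionality_dep => i; rewrite dfwith_seqE ?mem_enum.
elim: r => [|i r IH] /=.
  apply: (eq_integrable _ (cst 0%E)) => //; last exact: integrable0.
  by move=> w _ /=; rewrite subrr.
set u := dfwith_seq s0 s r in IH *.
have /eq_integrable : {in setT,
    (EFin \o (Phi (dfwith u i (s i)) \- Phi u)%R) \+ (EFin \o (Phi u \- Phi s0)%R)
    =1 EFin \o (Phi (dfwith u i (s i)) \- Phi s0)%R}%E.
  by move=> w _ /=; rewrite -EFinD subrKA.
by apply => //; apply: integrableD => //; exact: integrable_potential_step.
Qed.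

Lemma potential_game_expectation s0 :
  potential_game (fun i s => fine 'E_P[X i s]).
Proof.
exists (fun s => fine 'E_P[Phi s \- Phi s0]) => i s a a'; rewrite unlock.
rewrite -[LHS]RintegralB// -[RHS]RintegralB//;
  try exact: integrable_potential_diff.
(* The two copies of [Phi s0] cancel under a single integral. *)
by apply: eq_Rintegral => w _ /=; rewrite X_potential opprB subrKA.
Qed.

End ExpectedPotential.

(** [F i j h] stands for the interaction of [j] with [h] as weighted in the cost of [i]. *)
Lemma pairwise_potential {V : zmodType} {I : finType} {S : I -> Type}
    {c : I -> (forall i, S i) -> V} {K : I -> V}
    {F : I -> I -> I -> (forall i, S i) -> V} :
  (forall i s, c i s = K i + \sum_j \sum_h F i j h s) ->
  (forall i j h s l (a : S l), l != j -> l != h ->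
     F i j h (dfwith s l a) = F i j h s) ->
  (forall j h s, F j j h s = F h j h s) ->
  forall i s (a a' : S i),
    c i (dfwith s i a) - c i (dfwith s i a')
    = \sum_j \sum_h F j j h (dfwith s i a)
      - \sum_j \sum_h F j j h (dfwith s i a').
Proof.
move=> cE F_local F_agree i s a a'; rewrite !cE.
(* [D] is the gap between the cost of [i] and the potential, up to the constant [K i]. Its terms
   with [j] or [h] equal to [i] vanish, and the others ignore the strategy of [i]. *)
pose D u := \sum_j \sum_h (F i j h u - F j j h u).
have DE u : \sum_j \sum_h F i j h u = \sum_j \sum_h F j j h u + D u.
  rewrite -big_split; apply: eq_bigr => j _; rewrite -big_split.
  by apply: eq_bigr => h _; rewrite /= addrC subrK.
have D_dfwith b : D (dfwith s i b) = D s.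
  apply: eq_bigr => j _; apply: eq_bigr => h _.
  have [<-|ij] := eqVneq i j; first by rewrite !subrr.
  have [<-|ih] := eqVneq i h; first by rewrite !F_agree !subrr.
  by rewrite !F_local.
by rewrite !DE !D_dfwith opprD addrACA subrr add0r opprD addrACA subrr addr0.
Qed.

Lemma quad_form_mxblock {R : comPzRingType} {p : nat} {n : 'I_p -> nat}
    (Q : 'M[R]_(\sum_i n i)) (z : 'cV[R]_(\sum_i n i)) :
  z^T *m Q *m z
  = \sum_i \sum_j (submxcol z i)^T *m submxblock Q i j *m submxcol z j.
Proof.
rewrite -{1 2}(submxcolK z) -{1}(submxblockK Q) tr_mxcol mul_mxrow_mxblock.
rewrite mul_mxrow_mxcol exchange_big; apply: eq_bigr => j _.
by rewrite mulmx_suml.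
Qed.

Section PairwiseCosts.
Context {R : realType} {N tf : nat} {n : 'I_N -> nat}.
Variable G : lq_game R tf n.
Implicit Types (g : @profile R N tf n) (x : 'cV[R]_(\sum_(j < N) n j)).

(** The shift to time [t.+1] lets state terms and action terms share the index set ['I_tf], time 0
    being split off. *)
Definition state_dev g x (j : 'I_N) (t : 'I_tf) : 'cV[R]_(n j) :=
  state G g x j t.+1 - submxcol (target G (lift ord0 t)) j.

Definition pair_cost x (i j h : 'I_N) g : R :=
  \sum_(t < tf)
    (((state_dev g x j t)^T *m submxblock (Qcost G i (lift ord0 t)) j h
       *m state_dev g x h t) 0 0
     + action G g x j t * Rcost G i t j h * action G g x h t).

Definition initial_cost x (i : 'I_N) : R :=
  ((x - target G ord0)^T *m Qcost G i ord0 *m (x - target G ord0)) 0 0.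

Lemma path_costE x (i : 'I_N) g :
  path_cost G i g x
  = initial_cost x i + \sum_j \sum_h pair_cost x i j h g.
Proof.
rewrite /path_cost big_ord_recl -addrA; congr (_ + _).
  by rewrite /joint_state /= submxcolK.
rewrite -big_split /=.
under [RHS]eq_bigr do rewrite exchange_big /=.
rewrite exchange_big /=; apply: eq_bigr => t _.
rewrite quad_form_mxblock summxE -big_split; apply: eq_bigr => j _ /=.
rewrite summxE -big_split; apply: eq_bigr => h _ /=.
by rewrite !submxcolB !mxcolK.
Qed.

Lemma gain_dfwith g {l j : 'I_N} (a : @strategy R N tf n l) t :
  l != j -> gain (dfwith g l a) j t = gain g j t.
Proof. by move=> lj; rewrite /gain dfwithout. Qed.

(** Decoupling of both dynamics and feedback enters here: only the gains of [j] drive its state. *)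
Lemma state_dfwith g x {l j : 'I_N} (a : @strategy R N tf n l) t :
  l != j -> state G (dfwith g l a) x j t = state G g x j t.
Proof. by move=> lj; elim: t => //= t ->; rewrite /feedback gain_dfwith. Qed.

Lemma pair_cost_dfwith x (i j h : 'I_N) g {l : 'I_N}
    (a : @strategy R N tf n l) :
  l != j -> l != h -> pair_cost x i j h (dfwith g l a) = pair_cost x i j h g.
Proof.
move=> lj lh; apply: eq_bigr => t _.
by rewrite /state_dev /action /feedback !state_dfwith// !gain_dfwith.
Qed.

End PairwiseCosts.

Theorem theorem9 (R : realType) (N tf : nat) (n : 'I_N -> nat)
    (G : lq_game R tf n)
    (htf : (1 <= tf)%N)
    (hQ : forall (i : 'I_N) (t : 'I_tf.+1), psd (Qcost G i t))
    (hRsym : forall (i : 'I_N) (t : 'I_tf) (j h : 'I_N),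
      Rcost G i t j h = Rcost G i t h j)
    (hRge0 : forall (i : 'I_N) (t : 'I_tf) (l : 'I_N),
      l != i -> 0 <= Rcost G i t l l)
    (hRgt0 : forall (i : 'I_N) (t : 'I_tf), 0 < Rcost G i t i i)
    (hJ : real_losses G)
    (C1 : forall (i j : 'I_N) (t : 'I_tf),
      submxblock (Qcost G i (lift ord0 t)) i j
      = submxblock (Qcost G j (lift ord0 t)) i j)
    (C2 : forall (i j : 'I_N) (t : 'I_tf),
      Rcost G i t i j = Rcost G j t i j) :
  potential_game (loss G).
Proof.
apply: (potential_game_expectation (S := fun i => @strategy R N tf n i)
  (X := random_cost G)
  (Phi := fun g w => \sum_j \sum_h pair_cost G (\col_k tnth w k) j j h g)) => //.
  move=> i g a a' w; apply: (pairwise_potential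
    (c := fun l u => path_cost G l u (\col_k tnth w k))
    (K := initial_cost G (\col_k tnth w k))
    (F := pair_cost G (\col_k tnth w k))) => [k u|k j h u l b|j h u].
  - exact: path_costE.
  - exact: pair_cost_dfwith.
  - by apply: eq_bigr => t _; rewrite C1 C2.
(* The reference profile has all gains zero; any other profile would serve. *)
by move=> i; exact: 0.
Qed.
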